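(* Consider a surface with defects $(\mathbb{S}^2,\Gamma,K_4)$ as an element of $\mathrm{Mor}(\mathrm{Bord}_2^{\mathrm{def,cw}}(\mathcal{P}_{K_4}))$, and let $\bar{\mathbb{S}}^1$ be a generic cross-section of $(\mathbb{S}^2,\Gamma,K_4)$. Then the product in $K_4$ of the defects on $\bar{\mathbb{S}}^1$ equals $1$.
   Context: $K_4=\langle a,b,c\mid a^2=b^2=c^2=abc=1\rangle$ is the Klein four-group. A surface with defects $(\mathbb{S}^2,\Gamma,K_4)$ in $\mathrm{Mor}(\mathrm{Bord}_2^{\mathrm{def,cw}}(\mathcal{P}_{K_4}))$ is a trivalent graph $\Gamma$ embedded in $\mathbb{S}^2$ whose edges are labelled (''colored'') by elements of $\{a,b,c\}$ so that the three edges at each vertex have three different labels (together with a compatible PLCW decomposition of $\mathbb{S}^2$, which plays no role in the statement). Let $f:\mathbb{S}^2\to[0,1]$ be a height (Morse) function. A level set $f^{-1}(\{t\})$ is a generic cross-section if it is a circle with defects and there is $\epsilon>0$ such that $f^{-1}((t-\epsilon,t+\epsilon))$, with the labelled stratification induced by $\Gamma$, is isomorphic (by an orientation-, stratification- and label-preserving diffeomorphism) to an open cylinder or a collar over $f^{-1}(\{t\})$, i.e. to $f^{-1}(\{t\})\times(0,1)$ or $f^{-1}(\{t\})\times[0,1)$ with the product stratification. In particular a generic cross-section contains no vertex of $\Gamma$ and meets the edges of $\Gamma$ transversally in finitely many points. The defects on the cross-section are these intersection points, each labelled by the label in $\{a,b,c\}$ of the edge it lies on. Since $K_4$ is abelian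 and every element is its own inverse, the product does not depend on order or orientation. *)

(* Defs.v *)
From mathcomp Require Import all_boot all_order all_algebra.
From mathcomp Require Import fingroup morphism gproduct zmodp presentation.
Set Implicit Arguments.
Unset Strict Implicit.
Unset Printing Implicit Defensive.

(* ['Z_2] is a [finGroupType] for its addition, so [mulg] on [K4] is
   componentwise addition mod 2 and [1%g : K4] is [(0, 0)]. *)
Notation K4 := ('Z_2 * 'Z_2)%type.

Definition K4a : K4 := (1, 0)%R.
Definition K4b : K4 := (0, 1)%R.
Definition K4c : K4 := (1, 1)%R.

Lemma K4_relations :
  [/\ K4a ^+ 2 = 1, K4b ^+ 2 = 1, K4c ^+ 2 = 1 & K4a * K4b * K4c = 1]%g.
Proof. by split; apply/eqP. Qed.

Lemma K4_expE (p : K4) : p = (K4a ^+ p.1 * K4b ^+ p.2)%g.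
Proof. by case: p => [[[|[|]] // ?] [[|[|]] // ?]]; apply/eqP. Qed.

Lemma K4_presentation :
  ([set: K4] \isog Grp (a : b : c : a ^+ 2, b ^+ 2, c ^+ 2, a * b * c))%g.
Proof.
apply: intro_isoGrp => [|rT H].
  apply/existsP; exists (K4a, K4b, K4c); rewrite /= !xpair_eqE.
  rewrite [X in _ && X]/= andbT.
  rewrite eqEsubset subsetT /=; apply/subsetP => p _.
  have a_in : K4a \in (<[K4a]> <*> <[K4b]> <*> <[K4c]>)%g.
    by do 2!apply: (subsetP (joing_subl _ _)); exact: cycle_id.
  have b_in : K4b \in (<[K4a]> <*> <[K4b]> <*> <[K4c]>)%g.
    by apply: (subsetP (joing_subl _ _)); apply: (subsetP (joing_subr _ _)); exact: cycle_id.
  by rewrite (K4_expE p) groupM ?groupX.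
case/existsP => -[[x y] z] /=; rewrite !xpair_eqE => /and5P[].
move=> /eqP defH /eqP x2 /eqP y2 /eqP z2 /eqP xyz.
have Vx : (x^-1 = x)%g by apply/eqP; rewrite eq_invg_mul; apply/eqP; exact: x2.
have Vy : (y^-1 = y)%g by apply/eqP; rewrite eq_invg_mul; apply/eqP; exact: y2.
have zE : (z = y * x)%g.
  by rewrite -[z]mul1g -[1%g](mulVg (x * y)%g) -mulgA xyz mulg1 invMg Vx Vy.
have cxy : commute x y.
  have xyxy : (x * y * (y * x) = 1)%g by rewrite -zE.
  have : (z * z = 1)%g by exact: z2.
  rewrite zE => /eqP; rewrite -eq_invg_mul invMg Vx Vy => /eqP xy.
  by rewrite /commute xy.
pose h (p : K4) : rT := (x ^+ p.1 * y ^+ p.2)%g.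
have hM : {in [set: K4] &, {morph h : p q / p * q}}%g.
  move=> p q _ _; rewrite /h /=.
  have expM (w : rT) : (w ^+ 2 = 1)%g ->
      forall i j : 'Z_2, (w ^+ (i * j)%g = w ^+ i * w ^+ j)%g.
    by move=> w2 i j; rewrite -expgD -(expg_mod (i + j) w2).
  rewrite !expM // -!mulgA; congr (_ * _)%g; rewrite !mulgA; congr (_ * _)%g.
  by apply: commuteX2.
apply/homgP; exists (Morphism hM); rewrite -defH; apply/eqP; rewrite eqEsubset.
have x_in : x \in (<[x]> <*> <[y]> <*> <[z]>)%g.
  by do 2!apply: (subsetP (joing_subl _ _)); exact: cycle_id.
have y_in : y \in (<[x]> <*> <[y]> <*> <[z]>)%g.
  by apply: (subsetP (joing_subl _ _)); apply: (subsetP (joing_subr _ _)); exact: cycle_id.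
apply/andP; split.
  apply/subsetP => _ /morphimP[p _ _ ->] /=.
  by rewrite /h groupM ?groupX.
have im p : h p \in (Morphism hM @* [set: K4])%g.
  by rewrite -[h p]/(Morphism hM p) mem_morphim ?inE.
have xim : x \in (Morphism hM @* [set: K4])%g.
  by have := im K4a; rewrite /h /= expg0 mulg1.
have yim : y \in (Morphism hM @* [set: K4])%g.
  by have := im K4b; rewrite /h /= expg0 mul1g.
by rewrite !join_subG !cycle_subG xim yim zE groupM.
Qed.

From mathcomp Require Import all_classical all_reals all_analysis.

Import Order.TTheory GRing.Theory Num.Theory.
Import numFieldNormedType.Exports.

Local Open Scope classical_set_scope.
Local Open Scope ring_scope.

Section Smoothness.
Context {R : realType}.
Implicit Types U V : normedModType R.

(* Meaningful for an open [W] of a finite-dimensional [U]: all iterated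
   directional derivatives up to order [n] exist and are continuous on [W]. *)
Fixpoint class_C (n : nat) U V (W : set U) (g : U -> V) : Prop :=
  (forall x, W x -> {for x, continuous g}) /\
  match n with
  | 0 => True
  | m.+1 => forall v : U, (forall x, W x -> derivable g x v) /\
                          class_C m W (fun x => 'D_v g x)
  end.

(* Smoothness on an arbitrary subset of a Euclidean space, as in Milnor's
   "Topology from the differentiable viewpoint": local smooth extendability.
   Only the values of [g] on [A] matter. *)
Definition smooth_on U V (A : set U) (g : U -> V) : Prop :=
  forall x, A x -> exists (W : set U) (g' : U -> V),
    [/\ open W, W x, forall n, class_C n W g' &
        forall y, W y -> A y -> g' y = g y].

Definition diffeo U V (A : set U) (B : set V) (g : U -> V) : Prop :=
  exists h : V -> U,
    [/\ smooth_on A g /\ smooth_on B h,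
        forall x, A x -> B (g x), forall y, B y -> A (h y),
        forall x, A x -> h (g x) = x & forall y, B y -> g (h y) = y].

End Smoothness.

Definition S1 (R : realType) : set 'rV[R]_2 :=
  [set x | \sum_i x 0 i ^+ 2 = 1].

Definition S2 (R : realType) : set 'rV[R]_3 :=
  [set x | \sum_i x 0 i ^+ 2 = 1].

Arguments S1 R : clear implicits.
Arguments S2 R : clear implicits.

Section MorseFunctions.
Variable R : realType.

(* [phi], restricted to the open neighborhood [W] of [0], is a local
   parametrization of the 2-sphere around [p]. *)
Definition sphere_chart (p : 'rV[R]_3) (W : set 'rV[R]_2)
    (phi : 'rV[R]_2 -> 'rV[R]_3) : Prop :=
  [/\ open W, W 0, phi 0 = p, diffeo W (phi @` W) phi &
      exists2 O : set 'rV[R]_3, open O & phi @` W = O `&` S2 R].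

Definition critical_at0 (g : 'rV[R]_2 -> R^o) : Prop :=
  forall v, 'D_v g 0 = 0.

Definition hessian_at0 (g : 'rV[R]_2 -> R^o) : 'M[R]_2 :=
  \matrix_(i, j) 'D_(delta_mx 0 i) (fun x => 'D_(delta_mx 0 j) g x) 0.

(* A function on the sphere is the restriction of [f]; the values of [f]
   elsewhere are irrelevant. *)
Definition morse_function (f : 'rV[R]_3 -> R^o) : Prop :=
  smooth_on (S2 R) f /\
  forall p W phi, sphere_chart p W phi -> critical_at0 (f \o phi) ->
    \det (hessian_at0 (f \o phi)) != 0.

End MorseFunctions.

(* Half-edges at a vertex: an edge [e] with a choice [b] of one of its ends. *)
Definition half_edges (V E : finType) (ends : E -> bool -> V) (v : V) :
    {set E * bool} :=
  [set h : E * bool | ends h.1 h.2 == v]%SET.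

(* 1-strata are of two kinds: edges, and closed defect lines without vertex. *)
Definition stratum1 (R : realType) (E L : Type)
    (edge_map : E -> R^o -> 'rV[R]_3) (circle_map : L -> 'rV[R]_2 -> 'rV[R]_3)
    (k : E + L) : set 'rV[R]_3 :=
  match k with
  | inl e => edge_map e @` `]0, 1[
  | inr l => circle_map l @` S1 R
  end.

(* A trivalent graph embedded in the sphere, with its labelling. Lines of
   defects need not be oriented since every element of [K4] is its own
   inverse. *)
Record sphere_defects (R : realType) := SphereDefects {
  vertex : finType;
  edge : finType;
  circle : finType;
  ends : edge -> bool -> vertex;
  vpos : vertex -> 'rV[R]_3;
  edge_map : edge -> R^o -> 'rV[R]_3;
  circle_map : circle -> 'rV[R]_2 -> 'rV[R]_3;
  label : edge + circle -> K4;
  vpos_S2 : forall v, S2 R (vpos v);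
  vpos_inj : injective vpos;
  edge_map_continuous : forall e, {within `[0, 1], continuous (edge_map e)};
  edge_map0 : forall e, edge_map e 0 = vpos (ends e false);
  edge_map1 : forall e, edge_map e 1 = vpos (ends e true);
  edge_map_embedding :
    forall e, diffeo (`]0, 1[%classic : set R^o) (edge_map e @` `]0, 1[)
                     (edge_map e);
  circle_map_embedding :
    forall l, diffeo (S1 R) (circle_map l @` S1 R) (circle_map l);
  strata_S2 : forall k, stratum1 edge_map circle_map k `<=` S2 R;
  strata_vert : forall k v, ~ stratum1 edge_map circle_map k (vpos v);
  strata_disjoint : forall k k', k <> k' ->
    stratum1 edge_map circle_map k `&` stratum1 edge_map circle_map k' = set0;
  label_gen : forall k, label k \in [set K4a; K4b; K4c]%SET;
  trivalent : forall v, #|half_edges ends v| = 3%N;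
  label_vert : forall v,
    {in half_edges ends v &, injective (fun h => label (inl h.1))}
}.

Section CrossSections.
Variables (R : realType) (G : sphere_defects R).

Definition line (k : edge G + circle G) : set 'rV[R]_3 :=
  stratum1 (@edge_map R G) (@circle_map R G) k.

Definition lines_labelled (g : K4) : set 'rV[R]_3 :=
  [set x | exists2 k, label k = g & line k x].

Definition vertices : set 'rV[R]_3 := range (@vpos R G).

Definition level (f : 'rV[R]_3 -> R^o) (t : R) : set 'rV[R]_3 :=
  S2 R `&` [set x | f x = t].

Definition slab (f : 'rV[R]_3 -> R^o) (t eps : R) : set 'rV[R]_3 :=
  S2 R `&` [set x | t - eps < f x < t + eps].

(* A defect on the level set is recorded together with the (unique) line it
   lies on. *)
Definition defects (f : 'rV[R]_3 -> R^o) (t : R) :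
    set ((edge G + circle G) * 'rV[R]_3) :=
  [set kx | line kx.1 kx.2 /\ level f t kx.2].

Definition angle (theta : R) : 'rV[R]_2 :=
  \row_i (if i == 0 then cos theta else sin theta).

(* The circle [level f t] is oriented by its parametrization [c], the
   cylinder by the product orientation, and the sphere by the outward normal
   (first vector of a positive frame of the ambient space). *)
Definition orientation_preserving (c : 'rV[R]_2 -> 'rV[R]_3)
    (psi : 'rV[R]_3 * R^o -> 'rV[R]_3) : Prop :=
  forall theta s : R, 0 < s < 1 ->
    let p := psi (c (angle theta), s) in
    let dtheta := derive1 (fun u : R => psi (c (angle u), s)) theta in
    let ds := derive1 (fun u : R => psi (c (angle theta), u)) s in
    0 < \det (\matrix_(i < 3, j < 3) nth 0 [:: p; dtheta; ds] i 0 j).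

(* In the product stratification over a circle [C] with defects, there is no
   0-stratum, and [(y, s)] is on a line labelled [g] iff [y] is a defect
   labelled [g]. *)
Definition preserves_strata (C : set 'rV[R]_3) (I : set R^o)
    (psi : 'rV[R]_3 * R^o -> 'rV[R]_3) : Prop :=
  forall y s, C y -> I s -> ~ vertices (psi (y, s)) /\
    forall g, lines_labelled g (psi (y, s)) <-> lines_labelled g y.

Definition circle_with_defects (f : 'rV[R]_3 -> R^o) (t : R)
    (c : 'rV[R]_2 -> 'rV[R]_3) : Prop :=
  diffeo (S1 R) (level f t) c /\ finite_set (defects f t).

Definition generic_cross_section (f : 'rV[R]_3 -> R^o) (t : R) : Prop :=
  exists c, circle_with_defects f t c /\
  exists eps : R, 0 < eps /\
  exists (I : set R^o) (psi : 'rV[R]_3 * R^o -> 'rV[R]_3),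
    [/\ I = `]0, 1[%classic \/ I = `[0, 1[%classic,
        diffeo (level f t `*` I) (slab f t eps) psi,
        orientation_preserving c psi &
        preserves_strata (level f t) I psi].

End CrossSections.

Arguments defects {R} G f t.

(* Main.v *)
(* The argument is about the core circle K = psi (C x {1/2}) of the cylinder,
   not about the level set C itself, which need not separate the two ends of the
   cylinder; since psi preserves the strata, K carries the same labels as C.

   Let kappa be the cylinder coordinate rescaled to go from -1 to 1 around K,
   and 1 off the cylinder. The map (kappa + i sqrt (1 - kappa^2))^2 from the
   sphere to the unit circle is continuous, although kappa jumps from 1 to -1.
   The sphere being simply connected, it has a continuous square root, whose
   real part a is kappa up to sign: it vanishes exactly on K and changes sign
   across K. Counting sign changes, an edge meets K an even number of times iff
   a has the same sign at both ends, and a closed line always does. So the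
   product of the labels over K is the product, over the vertices where a is
   negative, of the labels of the three incident half-edges, which is abc = 1. *)
Require Import Defs.
From mathcomp Require Import all_boot all_order all_algebra.
From mathcomp Require Import fingroup.
From mathcomp Require Import all_classical all_reals all_analysis.
From mathcomp Require Import ring lra.

Import Order.TTheory GRing.Theory Num.Theory.
Import numFieldNormedType.Exports.

Set Implicit Arguments.
Unset Strict Implicit.
Unset Printing Implicit Defensive.

Local Open Scope classical_set_scope.
Local Open Scope ring_scope.

(** * Continuity on subsets, uniform continuity on compact sets *)

Lemma within_continuous_comp_sub (U V W : topologicalType) (A : set U)
    (B : set V) (f : U -> V) (g : V -> W) :
  {within A, continuous f} -> {within B, continuous g} ->
  (forall x, A x -> B (f x)) -> {within A, continuous (g \o f)}.
Proof.
move=> /subspace_continuousP cf /subspace_continuousP cg AB.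
apply/subspace_continuousP => x Ax.
move=> P /(cg _ (AB _ Ax)) /(cf _ Ax) /=.
by rewrite !nbhs_simpl /within /=; apply: filterS => y h Ay; exact: (h Ay (AB _ Ay)).
Qed.

(** Heine-Cantor: compactness, in its near-covering form, makes a modulus of continuity valid near
    each point valid on all of [K]. *)
Lemma compact_uniform_modulus (R : realType) (X : normedModType R) (K : set X)
    (g : X -> R) : compact K -> {within K, continuous g} ->
  forall e, 0 < e -> exists2 d, 0 < d & forall x y, K x -> K y ->
    `|x - y| < d -> `|g x - g y| < e.
Proof.
move=> /compact_near_coveringP/near_covering_withinP Kc.
move=> /subspace_continuousP gc e e0.
pose P (d : R) (x : X) := forall y, K y -> `|x - y| < d -> `|g x - g y| < e.
have : \forall d \near 0^'+, K `<=` P d.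
  apply: Kc => x Kx.
  have /cvgrPdist_lt /(_ (e / 2)) := gc _ Kx.
  rewrite divr_gt0 // => /(_ erefl); rewrite near_withinE => /nbhs_ballP[r /= r0 xr].
  (* Radii are halved so that [x'], close to [x], and [y], close to [x'], both stay within [r] of
     [x]. *)
  exists (ball x (r / 2), [set d | d < r / 2]) => /=.
    split; first by apply: nbhsx_ballx; rewrite divr_gt0.
    by apply: nbhs_right_lt; rewrite divr_gt0.
  case=> x' d /= [xx' dr] Kx' y Ky x'y.
  have h z : `|x - z| < r -> K z -> `|g x - g z| < e / 2.
    by move=> xz; apply: xr; rewrite -ball_normE.
  move: xx'; rewrite -ball_normE /= => xx'.
  rewrite -(subrKA (g x)) [e]splitr (le_lt_trans (ler_normD _ _)) // ltrD //.
    by rewrite distrC h // (lt_trans xx') // ltr_pdivrMr // ltr_pMr // ltr1n.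
  apply: h => //; rewrite -(subrKA x') [r]splitr (le_lt_trans (ler_normD _ _)) // ltrD //.
  exact: lt_trans dr.
move=> h; have [d [d0 Kd]] : exists d : R, 0 < d /\ K `<=` P d.
  near (0 : R)^'+ => d; exists d; split; last by near: d.
  by near: d; exact: nbhs_right_gt.
by exists d => // x y Kx; exact: Kd.
Unshelve. all: end_near. Qed.

Section WithinContinuity.
Context {R : realType} {X : topologicalType} (A : set X).
Implicit Types f g : X -> R.

Lemma withinD f g : {within A, continuous f} -> {within A, continuous g} ->
  {within A, continuous (fun x => f x + g x)}.
Proof. by move=> cf cg x; exact: continuousD (cf x) (cg x). Qed.

Lemma withinB f g : {within A, continuous f} -> {within A, continuous g} ->
  {within A, continuous (fun x => f x - g x)}.
Proof. by move=> cf cg x; exact: continuousB (cf x) (cg x). Qed.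

Lemma withinM f g : {within A, continuous f} -> {within A, continuous g} ->
  {within A, continuous (fun x => f x * g x)}.
Proof. by move=> cf cg x; exact: continuousM (cf x) (cg x). Qed.

Lemma within_cst (k : R) : {within A, continuous (fun=> k)}.
Proof. by move=> x; exact: cst_continuous. Qed.

Lemma within_comp f (g : R -> R) : {within A, continuous f} -> continuous g ->
  {within A, continuous (g \o f)}.
Proof. by move=> cf cg; apply: within_continuous_comp cf => y _; exact: cg. Qed.

End WithinContinuity.

Arguments within_cst {R X} A k x : rename.

(** * Square roots of circle-valued maps *)

Section SquareRootLifting.
Variable R : realType.

(** With [w = a + i b] and [w^2 = c + i s], the squared modulus of [w] is nonnegative and its square
    is [|w^2|^2 = 1]. *)
Lemma sqrt_circle_norm (a b c s : R) :
  c ^+ 2 + s ^+ 2 = 1 -> a ^+ 2 - b ^+ 2 = c -> 2 * a * b = s ->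
  a ^+ 2 + b ^+ 2 = 1.
Proof.
move=> cs ac bs; have h : (a ^+ 2 + b ^+ 2) ^+ 2 = 1 by rewrite -cs -ac -bs; ring.
by apply/eqP; rewrite -(eqrXn2 (n := 2)) // ?addr_ge0 ?sqr_ge0 // h expr1n.
Qed.

(* If [w] is a square root of [z], then [w * sqrt (z' / z)] is one of [z'], and the
   principal determination of [sqrt] is continuous as long as [z' <> - z]. *)
Lemma near_sqrt_exists (X : topologicalType) (A : set X) (c s c' s' a b : X -> R) :
  {within A, continuous c} -> {within A, continuous s} ->
  {within A, continuous c'} -> {within A, continuous s'} ->
  {within A, continuous a} -> {within A, continuous b} ->
  (forall x, A x -> c x ^+ 2 + s x ^+ 2 = 1) ->
  (forall x, A x -> c' x ^+ 2 + s' x ^+ 2 = 1) ->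
  (forall x, A x -> a x ^+ 2 - b x ^+ 2 = c x /\ 2 * a x * b x = s x) ->
  (forall x, A x -> `|c x - c' x| < 1 /\ `|s x - s' x| < 1) ->
  exists a' b' : X -> R, [/\ {within A, continuous a'}, {within A, continuous b'} &
   forall x, A x -> a' x ^+ 2 - b' x ^+ 2 = c' x /\ 2 * a' x * b' x = s' x].
Proof.
move=> cc sc c'c s'c ac bc cs1 cs1' ab close.
(* [p + i q] is the quotient [z' / z], since [z] has modulus 1. Its principal square root is
   [(1 + p + i q) / n]. *)
pose p x := c' x * c x + s' x * s x.
pose q x := s' x * c x - c' x * s x.
pose n x := Num.sqrt (2 * (1 + p x)).
(* Closeness gives [|z - z'|^2 = 2 - 2 p < 2], so the quotient stays away from -1. *)
have pgt x : A x -> 0 < 1 + p x.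
  move=> Ax; have [] := close _ Ax; rewrite !ltr_norml /p => /andP[h1 h2] /andP[h3 h4].
  have := cs1 _ Ax; have := cs1' _ Ax; nra.
have n0 x : A x -> n x != 0.
  by move=> Ax; rewrite gt_eqF // sqrtr_gt0 mulr_gt0 // pgt.
have pc : {within A, continuous (fun x => 1 + p x)}.
  by refine (withinD (within_cst A 1) (withinD (withinM _ _) (withinM _ _))).
have qc : {within A, continuous q} by refine (withinB (withinM _ _) (withinM _ _)).
have nc : {within A, continuous (fun x => (n x)^-1)}.
  apply/subspace_continuousP => x Ax; apply: cvgV; first exact: n0.
  move: x Ax; apply/subspace_continuousP.
  refine (within_comp (withinM (within_cst A 2) pc) _); exact: sqrt_continuous.
exists (fun x => (a x * (1 + p x) - b x * q x) * (n x)^-1).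
exists (fun x => (a x * q x + b x * (1 + p x)) * (n x)^-1).
split; first by refine (withinM (withinB (withinM _ _) (withinM _ _)) nc).
  by refine (withinM (withinD (withinM _ _) (withinM _ _)) nc).
move=> x Ax; have [ha hb] := ab _ Ax.
have n2 : (n x)^-1 ^+ 2 = (2 * (1 + p x))^-1.
  by rewrite exprVn sqr_sqrtr // mulr_ge0 // ltW // pgt.
have p0 : 1 + p x != 0 by rewrite gt_eqF // pgt.
have pq : q x ^+ 2 = 1 - p x ^+ 2.
  have -> : 1 = (c x ^+ 2 + s x ^+ 2) * (c' x ^+ 2 + s' x ^+ 2) by rewrite cs1 // cs1' // mulr1.
  by rewrite /q /p; ring.
have hp : p x * c x - q x * s x = c' x.
  rewrite -[c' x]mulr1 -(cs1 _ Ax) /p /q; ring.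
have hq : q x * c x + p x * s x = s' x.
  rewrite -[s' x]mulr1 -(cs1 _ Ax) /p /q; ring.
split.
- rewrite !exprMn n2 -mulrBl.
  apply: (canLR (mulfK _)); first by rewrite mulf_neq0 ?pnatr_eq0.
  transitivity ((c x * ((1 + p x) ^+ 2 - q x ^+ 2)) - s x * 2 * (1 + p x) * q x).
    by rewrite -ha -hb; ring.
  by rewrite pq -hp; ring.
- transitivity (2 * (a x * (1 + p x) - b x * q x) * (a x * q x + b x * (1 + p x)) * (n x)^-1 ^+ 2).
    by ring.
  rewrite n2; apply: (canLR (mulfK _)); first by rewrite mulf_neq0 ?pnatr_eq0.
  transitivity ((s x * ((1 + p x) ^+ 2 - q x ^+ 2)) + c x * 2 * (1 + p x) * q x).
    by rewrite -ha -hb; ring.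
  by rewrite pq -hq; ring.
Qed.

End SquareRootLifting.

Lemma nonvanishing_sign (R : realType) (g : R -> R) (a b : R) : a <= b ->
  {within `[a, b], continuous g} -> {in `[a, b], forall x, g x != 0} ->
  (g a < 0) = (g b < 0).
Proof.
move=> ab gc g0.
have ga : g a != 0 by apply: g0; rewrite in_itv /= lexx.
have gb : g b != 0 by apply: g0; rewrite in_itv /= lexx andbT.
apply/idP/idP => h; rewrite ltNge; apply/negP => h'.
  have [|x xab /eqP] := IVT (v := 0) ab gc; last by apply/negP/g0.
  by rewrite ge_min le_max (ltW h) h' orbT.
have [|x xab /eqP] := IVT (v := 0) ab gc; last by apply/negP/g0.
by rewrite ge_min le_max (ltW h) h' orbT.
Qed.

(** Time is cut into steps so short that consecutive maps satisfy the closeness condition of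
    [near_sqrt_exists], and the root is carried from one step to the next. Only the root at the
    final time is kept, without continuity in time. *)
Lemma homotopy_sqrt (R : realType) (X : normedModType R) (A : set X)
    (c s : R * X -> R) (a b : X -> R) :
  compact A ->
  {within `[0, 1] `*` A, continuous c} -> {within `[0, 1] `*` A, continuous s} ->
  (forall y, (`[0, 1] `*` A) y -> c y ^+ 2 + s y ^+ 2 = 1) ->
  {within A, continuous a} -> {within A, continuous b} ->
  (forall x, A x ->
    a x ^+ 2 - b x ^+ 2 = c (0, x) /\ 2 * a x * b x = s (0, x)) ->
  exists a' b' : X -> R,
    [/\ {within A, continuous a'}, {within A, continuous b'} &
     forall x, A x ->
       a' x ^+ 2 - b' x ^+ 2 = c (1, x) /\ 2 * a' x * b' x = s (1, x)].
Proof.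
move=> cA cc sc cs ac bc ab0.
have cK : compact (`[0 : R, 1] `*` A) by apply: compact_setX => //; exact: segment_compact.
(* The tolerance 1 is the one of [near_sqrt_exists]; the mesh [1 / N] is then taken below both
   moduli. *)
have [d1 d10 cd] := compact_uniform_modulus cK cc ltr01.
have [d2 d20 sd] := compact_uniform_modulus cK sc ltr01.
pose d := Num.min d1 d2.
have d0 : 0 < d by rewrite lt_min d10.
pose N := (Num.truncn d^-1).+1.
have N0 : 0 < N%:R :> R by rewrite ltr0n.
have Nd : N%:R^-1 < d.
  by rewrite -[d]invrK ltf_pV2 ?posrE ?invr_gt0 // truncnS_gt.
have slice (g : R * X -> R) (r : R) : {within `[0, 1] `*` A, continuous g} -> 0 <= r <= 1 ->
    {within A, continuous (fun x => g (r, x))}.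
  move=> gc r01; apply: (within_continuous_comp_sub (f := fun x => (r, x)) _ gc).
    apply: continuous_subspaceT => x.
    by apply: (cvg_pair (cvg_cst r) cvg_id).
  by move=> x Ax; split; rewrite //= in_itv.
have k01 k : (k <= N)%N -> 0 <= k%:R / N%:R :> R /\ k%:R / N%:R <= 1 :> R.
  by move=> kN; rewrite divr_ge0 //= ler_pdivrMr // mul1r ler_nat.
suff [a' [b' [ac' bc' ab']]] : exists a' b' : X -> R,
    [/\ {within A, continuous a'}, {within A, continuous b'} &
     forall x, A x -> a' x ^+ 2 - b' x ^+ 2 = c (N%:R / N%:R, x) /\
       2 * a' x * b' x = s (N%:R / N%:R, x)].
  by exists a', b'; split => // x /ab'; rewrite divff // gt_eqF.
have : (N <= N)%N by [].
(* Only the step counter, in the bound and in the numerators, is generalized; the mesh [1 / N] stays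
   fixed. *)
elim: {1 3 5}N => [_|k IH kN].
  by exists a, b; split => // x /ab0; rewrite mul0r.
have [a' [b' [ac' bc' ab']]] := IH (ltnW kN).
have /andP h0 := k01 _ (ltnW kN); have /andP h1 := k01 _ kN.
apply: (near_sqrt_exists (slice c _ cc h0) (slice s _ sc h0) (slice c _ cc h1)
  (slice s _ sc h1) ac' bc') => //.
- by move=> x Ax; apply: cs; split; rewrite //= in_itv.
- by move=> x Ax; apply: cs; split; rewrite //= in_itv.
move=> x Ax.
have kd : `|(k%:R / N%:R, x) - (k.+1%:R / N%:R, x)| < d.
  have -> : (k%:R / N%:R, x) - (k.+1%:R / N%:R, x) = (- N%:R^-1, 0) :> R * X.
    congr pair; last by rewrite /= subrr.
    by rewrite /= -natr1 mulrDl mul1r opprD addNKr.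
  by rewrite prod_normE /= normr0 normrN ger0_norm ?invr_ge0 ?ler0n // gt_max d0 Nd.
by split; [apply: cd|apply: sd]; rewrite /= ?in_itv //;
  rewrite (lt_le_trans kd) // ge_min lexx ?orbT.
Qed.

Lemma continuous_rV (R : realType) (X : topologicalType) n (F : X -> 'rV[R]_n) :
  (forall i, continuous (fun x => F x 0 i)) -> continuous F.
Proof.
move=> Fc x; apply/cvg_mx_entourageP => V eV.
rewrite near_map; apply: filter_forall => i; apply: filter_forall => j.
have /cvg_entourageP/(_ V eV) := Fc j x.
rewrite near_map; apply: filterS => y; rewrite (ord1 i) => h.
exact: mem_set.
Qed.

(** * The 2-sphere *)

Section Sphere.
Variable R : realType.
Notation S2 := (S2 R).

(** Half-angle formulas, the sign of [s] being given to the imaginary part. *)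
Lemma circle_sqrt (c s : R) : c ^+ 2 + s ^+ 2 = 1 ->
  exists a b : R, a ^+ 2 - b ^+ 2 = c /\ 2 * a * b = s.
Proof.
move=> cs; have c1 : 0 <= 1 + c by have := sqr_ge0 s; nra.
have c2 : 0 <= 1 - c by have := sqr_ge0 s; nra.
have h : 2 * Num.sqrt ((1 + c) / 2) * Num.sqrt ((1 - c) / 2) = `|s|.
  rewrite -mulrA -sqrtrM ?divr_ge0 // -sqrtr_sqr.
  have {1}-> : 2 = Num.sqrt (2 ^+ 2) :> R by rewrite sqrtr_sqr ger0_norm.
  rewrite -sqrtrM ?sqr_ge0 //.
  by congr Num.sqrt; rewrite (_ : s ^+ 2 = 1 - c ^+ 2); [field|lra].
exists (Num.sqrt ((1 + c) / 2)), ((-1) ^+ (s < 0)%R * Num.sqrt ((1 - c) / 2)).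
split; last by rewrite mulrCA h -numEsign.
by rewrite exprMn sqrr_sign mul1r !sqr_sqrtr ?divr_ge0 //; field.
Qed.

Definition hemisphere (e : R) : set 'rV[R]_3 := S2 `&` [set x | 0 <= e * x 0 2].

(* Radial contraction, in the projection to the equatorial plane, of the
   hemisphere [hemisphere e], [e = 1] or [-1], to its pole. *)
Definition contraction (e : R) (y : R * 'rV[R]_3) : 'rV[R]_3 :=
  \row_i [:: y.1 * y.2 0 0; y.1 * y.2 0 1;
             e * Num.sqrt (1 - y.1 ^+ 2 * (y.2 0 0 ^+ 2 + y.2 0 1 ^+ 2))]`_i.

Lemma S2E (x : 'rV[R]_3) :
  S2 x <-> x 0 0 ^+ 2 + x 0 1 ^+ 2 + x 0 2 ^+ 2 = 1.
Proof.
rewrite /S2 /= !big_ord_recl big_ord0 addr0 addrA.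
by have [-> ->] : lift ord0 ord0 = 1 :> 'I_3 /\ lift ord0 (lift ord0 ord0) = 2 :> 'I_3
  by split; apply/val_inj.
Qed.

Lemma contraction_continuous e : continuous (contraction e).
Proof.
have cc i : continuous (fun y : R * 'rV[R]_3 => y.2 0 i).
  move=> y; refine (@continuous_comp _ _ _ snd (fun v : 'rV[R]_3 => v 0 i) y cvg_snd _).
  exact: coord_continuous.
have c1 : continuous (fun y : R * 'rV[R]_3 => y.1) by move=> y; exact: cvg_fst.
apply: continuous_rV => i.
have -> : (fun y => contraction e y 0 i) = (fun y : R * 'rV[R]_3 =>
    [:: y.1 * y.2 0 0; y.1 * y.2 0 1;
        e * Num.sqrt (1 - y.1 ^+ 2 * (y.2 0 0 ^+ 2 + y.2 0 1 ^+ 2))]`_i).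
  by apply/funext => y; rewrite mxE.
case: i => [[|[|[|//]]]] ? /= y.
- exact: (continuousM (c1 y) (cc 0 y)).
- exact: (continuousM (c1 y) (cc 1 y)).
have sc : continuous (fun y : R * 'rV[R]_3 =>
    1 - y.1 ^+ 2 * (y.2 0 0 ^+ 2 + y.2 0 1 ^+ 2)).
  move=> z; refine (continuousB (@cst_continuous _ R 1 z) (continuousM _ (continuousD _ _))).
  - exact: (continuousM (c1 z) (c1 z)).
  - exact: (continuousM (cc 0 z) (cc 0 z)).
  - exact: (continuousM (cc 1 z) (cc 1 z)).
refine (continuousM (@cst_continuous _ R e y)
  (@continuous_comp _ _ _ _ (@Num.sqrt R) y (sc y) _)).
exact: sqrt_continuous.
Qed.

Lemma contraction_S2 e y : e ^+ 2 = 1 -> 0 <= y.1 <= 1 -> S2 y.2 -> S2 (contraction e y).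
Proof.
move=> e1 /andP[y0 y1] /S2E Sy; apply/S2E; rewrite !mxE /= !exprMn e1 mul1r sqr_sqrtr.
  by ring.
have h : y.1 ^+ 2 <= 1 by rewrite expr_le1.
have h2 : 0 <= y.1 ^+ 2 by rewrite sqr_ge0.
have := sqr_ge0 (y.2 0 2); nra.
Qed.

(** At time 0 every point is sent to the pole, so the homotopy starts at a constant map. *)
Lemma contraction0 e x x' : contraction e (0, x) = contraction e (0, x').
Proof. by apply/rowP => i; rewrite !mxE /= !(mul0r, expr0n). Qed.

Lemma contraction1 e x : e ^+ 2 = 1 -> hemisphere e x -> contraction e (1, x) = x.
Proof.
move=> e1 [/S2E Sx /= ex]; apply/rowP => i; rewrite mxE /= !mul1r.
(* On the sphere the radicand is the square of the height; the choice of hemisphere then fixes the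
   sign of the root. *)
rewrite (_ : 1 - _ = (e * x 0 2) ^+ 2); last first.
  by rewrite exprMn e1 expr1n !mul1r -Sx; ring.
rewrite sqrtr_sqr ger0_norm // mulrA -expr2 e1 mul1r.
by case: i => [[|[|[|//]]]] ? /=; congr (x _ _); apply/val_inj.
Qed.

(** A closed subset of the box [[-1, 1]^n]. The dimension is left free to cover both the circle and
    the 2-sphere. *)
Lemma compact_sphere n : compact [set x : 'rV[R]_n | \sum_i x 0 i ^+ 2 = 1].
Proof.
have box : compact [set x : 'rV[R]_n | forall i, `[-1, 1]%classic (x ord0 i)].
  refine (@rV_compact R n (fun=> `[-1, 1]%classic) _) => _; exact: segment_compact.
apply: subclosed_compact _ box _.
  apply: (@preimage_closed _ _ (fun x : 'rV[R]_n => \sum_i x 0 i ^+ 2) [set r | r = 1]);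
    last exact: closed_eq.
  move=> x _; apply: continuous_big => [|i _ {}x].
    exact: add_continuous.
  exact: (continuousM (@coord_continuous _ _ _ 0 i x) (@coord_continuous _ _ _ 0 i x)).
move=> x /= Sx i; rewrite in_itv /= -ler_norml -(@expr_le1 _ 2) // -normrX.
by rewrite ger0_norm ?sqr_ge0 // -Sx (bigD1 i) //= lerDl sumr_ge0 // => j _; exact: sqr_ge0.
Qed.

Lemma closed_hemisphere e : closed (hemisphere e).
Proof.
apply: closedI; first exact: compact_closed (@norm_hausdorff _ _) (@compact_sphere 3).
apply: (@preimage_closed _ _ (fun x : 'rV[R]_3 => e * x 0 2) [set r | 0 <= r]); last exact: closed_ge.
by move=> x _; exact: (continuousM (@cst_continuous _ R e x) (@coord_continuous _ _ _ 0 2 x)).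
Qed.

Lemma compact_hemisphere e : compact (hemisphere e).
Proof. by refine (subclosed_compact (@closed_hemisphere e) (@compact_sphere 3) _) => x []. Qed.

(** Composition with [contraction e] is a homotopy from a constant map, which has a constant root,
    to the given map. *)
Lemma hemisphere_sqrt (c s : 'rV[R]_3 -> R) (e : R) : e ^+ 2 = 1 ->
  {within S2, continuous c} -> {within S2, continuous s} ->
  (forall x, S2 x -> c x ^+ 2 + s x ^+ 2 = 1) ->
  exists a b : 'rV[R]_3 -> R,
    [/\ {within hemisphere e, continuous a}, {within hemisphere e, continuous b} &
     forall x, hemisphere e x -> a x ^+ 2 - b x ^+ 2 = c x /\ 2 * a x * b x = s x].
Proof.
move=> e1 cc sc cs.
have lift (g : 'rV[R]_3 -> R) : {within S2, continuous g} ->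
    {within `[0, 1] `*` hemisphere e, continuous (g \o contraction e)}.
  move=> gc; apply: (within_continuous_comp_sub _ gc).
    by apply: continuous_subspaceT; exact: contraction_continuous.
  move=> y [/= + [Sy _]]; rewrite in_itv => y01; exact: contraction_S2.
have [p Sp p0] : exists2 p, S2 p & forall x, contraction e (0, x) = p.
  (* An arbitrary point of the equator, which serves to name the common value [p] at time 0. *)
  pose n : 'rV[R]_3 := delta_mx 0 0.
  have Sn : S2 n by apply/S2E; rewrite !mxE /= !expr0n expr1n !addr0.
  exists (contraction e (0, n)); last by move=> x; exact: contraction0.
  by apply: contraction_S2; rewrite //= lexx ler01.
have [a0 [b0 ab0]] := circle_sqrt (cs _ Sp).
have [|||x _|a [b [ac bc ab]]] := homotopy_sqrt (a := fun=> a0) (b := fun=> b0)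
  (@compact_hemisphere e) (lift c cc) (lift s sc).
- move=> [r x] [/= + [Sx _]]; rewrite in_itv => r01.
  by apply: cs; exact: contraction_S2.
- exact: within_cst.
- exact: within_cst.
- by rewrite /= p0.
exists a, b; split => // x ex.
by have := ab x ex; rewrite /= contraction1.
Qed.

Lemma cos_sin_surj (a b : R) : a ^+ 2 + b ^+ 2 = 1 ->
  exists t, [/\ - pi <= t <= pi, cos t = a & sin t = b].
Proof.
move=> ab; have a1 : -1 <= a <= 1.
  by rewrite -ler_norml -(@expr_le1 _ 2) // -normrX ger0_norm ?sqr_ge0 // -ab lerDl sqr_ge0.
have ca : cos (acos a) = a by rewrite acosK // in_itv.
have sa : sin (acos a) = `|b|.
  by rewrite sin_acos // -ab addrAC subrr add0r sqrtr_sqr.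
have p0 := acos_ge0 a1; have p1 := acos_lepi a1; have pi0 := pi_ge0 R.
have [b0|b0] := leP 0 b.
  exists (acos a); rewrite ca sa ger0_norm //; split => //.
  by rewrite p1 andbT (le_trans _ p0) // oppr_le0.
exists (- acos a); rewrite cosN sinN ca sa ltr0_norm // opprK lerN2; split => //.
by rewrite p1 (le_trans _ pi0) // oppr_le0.
Qed.

(** The roots on the two closed hemispheres agree up to sign at each point of the equator. The
    equator being connected, the sign is constant; multiplying the southern root by it makes the two
    glue. *)
Lemma sphere_sqrt (c s : 'rV[R]_3 -> R) :
  {within S2, continuous c} -> {within S2, continuous s} ->
  (forall x, S2 x -> c x ^+ 2 + s x ^+ 2 = 1) ->
  exists a b : 'rV[R]_3 -> R,
    [/\ {within S2, continuous a}, {within S2, continuous b} &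
     forall x, S2 x -> a x ^+ 2 - b x ^+ 2 = c x /\ 2 * a x * b x = s x].
Proof.
move=> cc sc cs.
have [|a1 [b1 [ac1 bc1 ab1]]] := hemisphere_sqrt (e := 1) _ cc sc cs; first by rewrite expr1n.
have [|a2 [b2 [ac2 bc2 ab2]]] := hemisphere_sqrt (e := -1) _ cc sc cs; first by rewrite sqrrN expr1n.
pose eq t : 'rV[R]_3 := \row_i [:: cos t; sin t; 0]`_i.
have Seq t : S2 (eq t) by apply/S2E; rewrite !mxE /= expr0n addr0 cos2Dsin2.
have eq2 t : eq t 0 2 = 0 by rewrite mxE.
have eqc : continuous eq.
  apply: continuous_rV => i.
  have -> : (fun t => eq t 0 i) = (fun t => [:: cos t; sin t; 0]`_i).
    by apply/funext => t; rewrite mxE.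
  case: i => [[|[|[|//]]]] ? /=; [exact: continuous_cos|exact: continuous_sin|].
  by move=> t; exact: cst_continuous.
have eq_hemi e t : hemisphere e (eq t) by split => //=; rewrite eq2 mulr0.
have eq_surj x : S2 x -> x 0 2 = 0 -> exists t, x = eq t.
  move=> /S2E + x2; rewrite x2 expr0n addr0 => /cos_sin_surj[t [_ ct st]]; exists t.
  by apply/rowP => -[[|[|[|//]]]] i; rewrite !mxE /= ?ct ?st -?x2; congr (x _ _); apply/val_inj.
have ceq e (g : 'rV[R]_3 -> R) : {within hemisphere e, continuous g} -> {within setT, continuous (g \o eq)}.
  move=> gc; refine (within_continuous_comp_sub (continuous_subspaceT eqc) gc _) => t _.
  exact: eq_hemi.
(* The real part of [w1] times the conjugate of [w2]: for roots of modulus 1 that agree up to sign,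
   it is that sign. *)
pose g t : R := a1 (eq t) * a2 (eq t) + b1 (eq t) * b2 (eq t).
have gc : {within setT, continuous g}.
  exact: withinD (withinM (ceq _ _ ac1) (ceq _ _ ac2)) (withinM (ceq _ _ bc1) (ceq _ _ bc2)).
have gs t : [/\ g t ^+ 2 = 1, a1 (eq t) = g t * a2 (eq t) & b1 (eq t) = g t * b2 (eq t)].
  have [e1 e1'] := ab1 _ (eq_hemi 1 t); have [e2 e2'] := ab2 _ (eq_hemi (-1) t).
  have n1 := sqrt_circle_norm (cs _ (Seq t)) e1 e1'.
  have n2 := sqrt_circle_norm (cs _ (Seq t)) e2 e2'.
  have := cs _ (Seq t).
  rewrite /g; move: (a1 _) (a2 _) (b1 _) (b2 _) (c _) (s _) e1 e1' e2 e2' n1 n2.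
  move=> x1 x2 y1 y2 cz sz e1 e1' e2 e2' n1 n2 csz.
  have xx : x1 ^+ 2 = x2 ^+ 2 by lra.
  have yy : y1 ^+ 2 = y2 ^+ 2 by lra.
  have xy : x1 * y1 = x2 * y2 by lra.
  split.
  - rewrite (_ : _ ^+ 2 = x1 ^+ 2 * x2 ^+ 2 + y1 ^+ 2 * y2 ^+ 2 + 2 * (x1 * y1) * (x2 * y2)); last by ring.
    rewrite xx yy xy; transitivity ((x2 ^+ 2 + y2 ^+ 2) ^+ 2); first by ring.
    by rewrite n2 expr1n.
  - transitivity (x1 * x2 ^+ 2 + y1 * (x2 * y2)); last by ring.
    by rewrite -xy -xx -{1}[x1]mulr1 -n1; ring.
  - transitivity (x1 * (x2 * y2) + y1 * y2 ^+ 2); last by ring.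
    by rewrite -xy -yy -{1}[y1]mulr1 -n1; ring.
(* A continuous function with values 1 and -1 does not vanish, hence keeps its sign and is
   constant. *)
have [e e1 ge] : exists2 e, e ^+ 2 = 1 & forall t, g t = e.
  exists (g 0) => [|t]; first by case: (gs 0).
  have g0 u : g u != 0 by have [gu _ _] := gs u; rewrite -(@sqrf_eq0 R) gu oner_eq0.
  have sgn u v : u <= v -> (g u < 0) = (g v < 0).
    move=> uv; apply: nonvanishing_sign => //.
    exact: continuous_subspaceW gc.
  have {sgn} : (g t < 0) = (g 0 < 0).
    by have [/sgn ->|/ltW/sgn ->] := leP t 0.
  have [gt2 _ _] := gs t; have [g02 _ _] := gs 0.
  have : (g t - g 0) * (g t + g 0) = 0 by rewrite -subr_sqr gt2 g02 subrr.
  move=> /eqP; rewrite mulf_eq0 subr_eq0 => /orP[/eqP//|]; rewrite addr_eq0 => /eqP ->.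
  by rewrite oppr_lt0; case: ltgtP (g0 0).
pose a (x : 'rV[R]_3) := if 0 <= x 0 2 then a1 x else e * a2 x.
pose b (x : 'rV[R]_3) := if 0 <= x 0 2 then b1 x else e * b2 x.
have S2U : S2 = hemisphere 1 `|` hemisphere (-1).
  apply/seteqP; split => [x Sx|x [] [] //].
  by case: (leP 0 (x 0 2)) => x2; [left|right]; split; rewrite //= ?mul1r // mulN1r oppr_ge0 ltW.
have glue (u1 u2 : 'rV[R]_3 -> R) : (forall t, u1 (eq t) = e * u2 (eq t)) ->
    {within hemisphere 1, continuous u1} -> {within hemisphere (-1), continuous u2} ->
    {within S2, continuous (fun x => if 0 <= x 0 2 then u1 x else e * u2 x)}.
  move=> u12 uc1 uc2; rewrite S2U; apply: withinU_continuous; try exact: closed_hemisphere.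
    apply: subspace_eq_continuous uc1 => x /set_mem[_ /=]; rewrite mul1r.
    by rewrite /from_subspace => ->.
  apply: subspace_eq_continuous (withinM (within_cst _ e) uc2) => x /set_mem[Sx /=].
  rewrite /from_subspace mulN1r oppr_ge0 le_eqVlt => /orP[/eqP x2|x2]; last by rewrite leNgt x2.
  by have [t ->] := eq_surj x Sx x2; rewrite eq2 lexx u12.
exists a, b; split.
- by apply: glue => // t; have [_ -> _] := gs t; rewrite ge.
- by apply: glue => // t; have [_ _ ->] := gs t; rewrite ge.
move=> x Sx; rewrite /a /b; case: leP => x2.
  by apply: ab1; split; rewrite //= mul1r.
have [<- <-] : a2 x ^+ 2 - b2 x ^+ 2 = c x /\ 2 * a2 x * b2 x = s x.
  by apply: ab2; split; rewrite //= mulN1r oppr_ge0 ltW.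
rewrite !exprMn e1 !mul1r; split => //.
by rewrite -[RHS]mul1r -e1; ring.
Qed.

End Sphere.

(** * Counting sign changes *)

Lemma seq_strict_ub (R : realFieldType) (z : R) (s : seq R) :
  {in s, forall x, x < z} -> exists2 m, m < z & {in s, forall x, x < m}.
Proof.
elim: s => [_|x s IH sz]; first by exists (z - 1) => //; rewrite ltrBlDr ltrDl.
have [|m mz sm] := IH; first by move=> y ys; apply: sz; rewrite inE ys orbT.
have xz : x < z by apply: sz; rewrite mem_head.
exists (Num.max m ((x + z) / 2)); first by rewrite gt_max mz midf_lt.
move=> y; rewrite inE lt_max => /predU1P[->|/sm ->//].
by rewrite midf_lt ?orbT.
Qed.

Lemma seq_max (R : realFieldType) (x0 : R) (s : seq R) :
  exists2 z, z \in x0 :: s & {in x0 :: s, forall x, x <= z}.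
Proof.
elim: s x0 => [x0|y s IH x0]; first by exists x0; rewrite ?mem_head // => x /[!inE] /eqP->.
have [z zs zm] := IH y.
have [x0z|zx0] := leP x0 z.
  by exists z; [rewrite inE zs orbT|move=> x; rewrite inE => /predU1P[->//|/zm]].
exists x0; first by rewrite mem_head.
by move=> x; rewrite inE => /predU1P[->//|/zm xz]; exact: le_trans xz (ltW zx0).
Qed.

(** Induction on the number of zeros, with the right end [b] free: the largest zero [z] is removed,
    [g] changes sign across it and keeps its sign from there to [b]. *)
Lemma sign_parity (R : realType) (g : R -> R) (a b : R) (zs : seq R) :
  a < b -> {within `[a, b], continuous g} -> g a != 0 -> g b != 0 ->
  uniq zs -> {subset zs <= `]a, b[} ->
  {in `]a, b[, forall u, (g u == 0) = (u \in zs)} ->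
  {in zs, forall z, exists2 d, 0 < d &
    forall u v, z - d < u < z -> z < v < z + d -> g u * g v < 0} ->
  (g a < 0) (+) (g b < 0) = odd (size zs).
Proof.
move=> + + ga; have [n] := ubnP (size zs); elim: n => // n IH in b zs *.
case: zs => [|z0 zs0] szn ab gc gb uzs zsab gz gs.
  rewrite (nonvanishing_sign (ltW ab) gc) ?addbb // => x.
  rewrite in_itv /= => /andP[]; rewrite le_eqVlt => /predU1P[<- //|ax].
  by rewrite le_eqVlt => /predU1P[->//|xb]; rewrite gz ?in_itv /= ?ax.
move: szn uzs zsab gz gs (seq_max z0 zs0).
move: (z0 :: zs0) => {z0 zs0} zs szn uzs zsab gz gs [z zzs zmax].
have [d d0 gd] := gs z zzs.
have : z \in `]a, b[ by exact: zsab.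
rewrite in_itv /= => /andP[az zb].
have ltz x : x \in rem z zs -> x < z.
  by rewrite mem_rem_uniq // inE => /andP[xz /zmax]; rewrite le_eqVlt (negPf xz).
(* [m] lies before [z] but beyond [a], [z - d] and all other zeros, so it can replace [b] in the
   induction; [v] below is its counterpart after [z]. *)
have [|m mz ltm] := @seq_strict_ub _ z [:: a, z - d & rem z zs].
  move=> x; rewrite !inE => /or3P[/eqP->//|/eqP->|/ltz//].
  by rewrite ltrBlDr ltrDl.
have am : a < m by apply: ltm; rewrite mem_head.
have dm : z - d < m by apply: ltm; rewrite !inE eqxx orbT.
pose v := (z + Num.min (z + d) b) / 2.
have zv : z < Num.min (z + d) b by rewrite lt_min ltrDl d0.
have [zlv] : z < v /\ v < Num.min (z + d) b by rewrite /v !midf_lt.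
rewrite lt_min => /andP[vd vb].
have mb : m < b := lt_trans mz zb.
have gmv : g m * g v < 0 by apply: gd; rewrite ?dm ?zlv.
have gm : g m != 0 by apply: contraTneq gmv => ->; rewrite mul0r ltxx.
have <- : (g v < 0) = (g b < 0).
  apply: nonvanishing_sign; first exact: ltW.
    apply: continuous_subspaceW gc => x /=; rewrite !in_itv /= => /andP[vx ->].
    by rewrite andbT ltW // (lt_trans az) // (lt_le_trans zlv).
  move=> x; rewrite in_itv /= => /andP[vx]; rewrite le_eqVlt => /predU1P[->//|xb].
  have zx := lt_le_trans zlv vx.
  rewrite gz ?in_itv /= ?(lt_trans az zx) //; apply/negP => /zmax.
  by rewrite leNgt zx.
have : (g a < 0) (+) (g m < 0) = odd (size (rem z zs)).
  apply: IH => //.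
  - by rewrite size_rem //; case: (zs) szn zzs.
  - apply: continuous_subspaceW gc => x /=; rewrite !in_itv /= => /andP[-> xm] /=.
    by rewrite (le_trans xm) // ltW.
  - exact: rem_uniq.
  - move=> x xzs; have := zsab _ (mem_rem xzs); rewrite !in_itv /= => /andP[-> _] /=.
    by apply: ltm; rewrite !inE xzs !orbT.
  - move=> x; rewrite in_itv /= => /andP[ax xm].
    rewrite gz ?in_itv /= ?ax ?(lt_trans xm) // mem_rem_uniq // inE.
    by rewrite lt_eqF // (lt_trans xm).
  - by move=> x /mem_rem; exact: gs.
have -> : odd (size zs) = ~~ odd (size (rem z zs)).
  by rewrite (perm_size (perm_to_rem zzs)).
move=> <-.
have -> : (g v < 0) = ~~ (g m < 0).
  have [gm0|gm0|gm0] := ltgtP (g m) 0.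
  - by move: gmv; rewrite nmulr_rlt0 // => /lt_gtF ->.
  - by move: gmv; rewrite pmulr_rlt0.
  - by rewrite gm0 eqxx in gm.
by rewrite addbN.
Qed.

(** * A function changing sign across the core of a cylinder *)

(** The local extension is of class C^0, and coincides with [g] on [A] near the point. *)
Lemma smooth_on_continuous (R : realType) (U V : normedModType R) (A : set U)
    (g : U -> V) : smooth_on A g -> {within A, continuous g}.
Proof.
move=> gs; apply/subspace_continuousP => x Ax P gP.
have [W [g' [oW Wx /(_ 0)[/(_ x Wx) cg' _] gg']]] := gs x Ax.
have {}gP : nbhs (g' x) P by rewrite gg'.
have {}gP : \forall y \near x, P (g' y) := cg' _ gP.
suff : \forall y \near x, A y -> P (g y) by [].
have := open_nbhs_nbhs (conj oW Wx); apply: filterS2 gP => y Py Wy Ay.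
by rewrite -gg'.
Qed.

Definition clamp (R : realType) (r : R) : R := Num.max (-1) (Num.min 1 r).

Lemma clamp_continuous (R : realType) : continuous (@clamp R).
Proof.
move=> x; refine (continuous_max (@cst_continuous _ _ _ x) _).
exact: (continuous_min (@cst_continuous _ _ _ x) cvg_id).
Qed.

Lemma clamp_abs (R : realType) (r : R) : `|clamp r| <= 1.
Proof. by rewrite ler_norml le_max lexx ge_max ge_min lexx /= (le_trans (lerN10 R) ler01). Qed.

Lemma clamp_id (R : realType) (r : R) : -1 <= r <= 1 -> clamp r = r.
Proof. by move=> /andP[r1 r2]; rewrite /clamp (min_idPr _) // (max_idPr _). Qed.

Lemma clamp_cases (R : realType) (r : R) :
  [\/ clamp r = 1, clamp r = -1 | -1 < r < 1].
Proof.
have [r1|r1] := leP r (-1).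
  by apply: Or32; rewrite /clamp (max_idPl _) // ge_min r1 orbT.
have [r2|r2] := leP 1 r; last by apply: Or33.
by apply: Or31; rewrite /clamp (min_idPl _) // (max_idPr _) // (le_trans (lerN10 R) ler01).
Qed.

Section Cylinder.
Variables (R : realType) (C W : set 'rV[R]_3) (I : set R^o).
Variables (psi : 'rV[R]_3 * R^o -> 'rV[R]_3) (h : 'rV[R]_3 -> 'rV[R]_3 * R^o).
Notation S2 := (S2 R).
Hypothesis cC : compact C.
Hypothesis I_core : forall s : R, 1 / 4 <= s <= 3 / 4 -> I s.
Hypothesis psi_cont : {within C `*` I, continuous psi}.
Hypothesis h_cont : {within W, continuous h}.
Hypothesis psi_W : forall y, (C `*` I) y -> W (psi y).
Hypothesis h_CI : forall x, W x -> (C `*` I) (h x).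
Hypothesis psiK : forall y, (C `*` I) y -> h (psi y) = y.
Hypothesis hK : forall x, W x -> psi (h x) = x.
Hypothesis W_open : forall x, W x -> \forall y \near within S2 (nbhs x), W y.

(** The affine coordinate that maps [[1/4, 3/4]] onto [[-1, 1]] and vanishes on the core circle. *)
Let core (p : 'rV[R]_3 * R^o) : R := 4 * p.2 - 2.

Let core_continuous : continuous core.
Proof.
move=> p.
exact: continuousB (continuousM (@cst_continuous _ R 4 p) (@cvg_snd _ _ _ _ _))
  (@cst_continuous _ R 2 p).
Qed.

Let kappa (x : 'rV[R]_3) : R :=
  if `[< W x >] then clamp (core (h x)) else 1.

(** [W] is relatively open in the sphere, so limits within [W] are limits within the sphere. *)
Lemma h_cvg_S2 x : W x -> h @ within S2 (nbhs x) --> h x.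
Proof.
move=> Wx P hP; have /subspace_continuousP/(_ x Wx) hc := h_cont.
have {}hc : \forall y \near x, W y -> P (h y) := hc _ hP.
suff : \forall y \near x, S2 y -> P (h y) by [].
have : \forall y \near x, S2 y -> W y := W_open Wx.
by apply: filterS2 hc => y WP SW /SW/WP.
Qed.

(** Within [W] this is a composition. At a point off [W], [kappa] takes only the values 1 and -1
    nearby, and [g] does not distinguish them. *)
Let kappa_comp_continuous (g : R -> R) :
  continuous g -> g (-1) = g 1 -> {within S2, continuous (g \o kappa)}.
Proof.
move=> gc g1; apply/subspace_continuousP => x Sx.
have [Wx|nWx] := pselect (W x).
  have kc : kappa @ within S2 (nbhs x) --> clamp (core (h x)).
    apply: (@cvg_trans _ ((fun y => clamp (core (h y))) @ within S2 (nbhs x))).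
      apply: near_eq_cvg; apply: filterS (W_open Wx) => y Wy.
      by rewrite /kappa asboolT.
    have hc := cvg_comp _ _ (h_cvg_S2 Wx) (@core_continuous (h x)).
    exact: (cvg_comp _ _ hc (@clamp_continuous R (core (h x)))).
  have kx : kappa x = clamp (core (h x)) by rewrite /kappa asboolT.
  rewrite -kx in kc.
  exact: (cvg_comp _ _ kc (@gc _)).
(* The band where [kappa] may differ from 1 and -1 is compact, hence closed, and avoids a
   neighborhood of any point off [W]. *)
pose K := psi @` (C `*` [set s : R^o | 1 / 4 <= s <= 3 / 4]).
have KW : K `<=` W by move=> _ [y [Cy Iy] <-]; apply: psi_W; split => //; exact: I_core.
have cK : compact K.
  apply: continuous_compact.
    by apply: continuous_subspaceW psi_cont => y [Cy Iy]; split => //; exact: I_core.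
  apply: compact_setX => //.
  have -> : [set s : R^o | 1 / 4 <= s <= 3 / 4] = `[1 / 4, 3 / 4]%classic.
    by apply/seteqP; split => s; rewrite /= in_itv.
  exact: segment_compact.
have : closed K by exact: compact_closed (@norm_hausdorff _ _) cK.
rewrite -openC => oK; have := open_nbhs_nbhs (conj oK _) => /(_ x).
have nKx : (~` K) x by move=> /KW.
move=> /(_ nKx) nearK P gP.
suff : \forall y \near x, S2 y -> P (g (kappa y)) by [].
have {gP} Pg1 : P (g 1).
  have <- : kappa x = 1 by rewrite /kappa asboolF.
  exact: nbhs_singleton gP.
apply: filterS nearK => y nKy _; rewrite /kappa; case: asboolP => // Wy.
case: (clamp_cases (core (h y))) => [->//|->|]; first by rewrite g1.
rewrite /core => /andP[h1 h2]; exfalso; apply: nKy; exists (h y); last exact: hK.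
by split; [exact: (h_CI Wy).1|apply/andP; split; lra].
Qed.

(** The root [a + i b] satisfies [a^2 = kappa^2] and [b^2 = 1 - kappa^2]. Near the core [b] keeps
    its sign, and [2 a b = 2 kappa |b|] then shows that [a] is [kappa] up to a locally constant
    sign. *)
Lemma cylinder_separation : exists a : 'rV[R]_3 -> R,
  [/\ {within S2, continuous a},
      forall x, S2 x -> a x = 0 -> W x /\ (h x).2 = 1 / 2 &
      forall x, S2 x -> W x -> (h x).2 = 1 / 2 -> exists2 e, e != 0 &
        \forall y \near within S2 (nbhs x), a y = e * ((h y).2 - 1 / 2)].
Proof.
have k1 x : 0 <= 1 - kappa x ^+ 2.
  rewrite subr_ge0 -[leLHS]ger0_norm ?sqr_ge0 // normrX expr_le1 // /kappa.
  by case: ifP => _; rewrite ?clamp_abs // normr1.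
pose c x := 2 * kappa x ^+ 2 - 1.
pose s x := 2 * kappa x * Num.sqrt (1 - kappa x ^+ 2).
have Mc (u v : R -> R) : continuous u -> continuous v -> continuous (fun r => u r * v r).
  by move=> uc vc r; exact: continuousM (uc r) (vc r).
have idc : continuous (fun r : R => r) by move=> r; exact: cvg_id.
have kc (r0 : R) : continuous (fun _ : R => r0) by move=> r; exact: cst_continuous.
have Bc (u v : R -> R) : continuous u -> continuous v -> continuous (fun r => u r - v r).
  by move=> uc vc r; exact: continuousB (uc r) (vc r).
have cc : {within S2, continuous c}.
  apply: (@kappa_comp_continuous (fun r => 2 * (r * r) - 1)); last by ring.
  exact: Bc (Mc _ _ (kc 2) (Mc _ _ idc idc)) (kc 1).
have sc : {within S2, continuous s}.
  apply: (@kappa_comp_continuous (fun r => 2 * r * Num.sqrt (1 - r * r))).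
    apply: (Mc _ _ (Mc _ _ (kc 2) idc) _) => r.
    exact: (continuous_comp (Bc _ _ (kc 1) (Mc _ _ idc idc) r) (@sqrt_continuous R _)).
  by rewrite mulrNN !mul1r subrr sqrtr0 !mulr0.
have cs x : S2 x -> c x ^+ 2 + s x ^+ 2 = 1.
  by move=> _; rewrite /c /s exprMn sqr_sqrtr //; ring.
have [a [b [ac bc ab]]] := sphere_sqrt cc sc cs.
have a2 x : S2 x -> a x ^+ 2 = kappa x ^+ 2.
  move=> Sx; have [h1 h2] := ab x Sx; have := sqrt_circle_norm (cs x Sx) h1 h2.
  by move: h1; rewrite /c; lra.
have b2 x : S2 x -> b x ^+ 2 = 1 - kappa x ^+ 2.
  move=> Sx; have [h1 h2] := ab x Sx; have := sqrt_circle_norm (cs x Sx) h1 h2.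
  by move: h1; rewrite /c; lra.
exists a; split => // [x Sx ax|x Sx Wx hx].
  have : kappa x = 0 by apply/eqP; rewrite -sqrf_eq0 -a2 // ax expr0n.
  rewrite /kappa; case: asboolP => [Wx k0|_ /eqP]; last by rewrite oner_eq0.
  split => //; have /eqP := k0.
  case: (clamp_cases (core (h x))) => [->|->|]; rewrite ?oppr_eq0 ?oner_eq0 //.
  by move=> /andP[h1 h2]; rewrite clamp_id ?(ltW h1) ?ltW // => /eqP; rewrite /core; lra.
have kx : kappa x = 0.
  rewrite /kappa asboolT // /core hx.
  rewrite clamp_id; last by apply/andP; split; lra.
  by field.
(* [4] is the slope of [core], and [b x] is 1 or -1 because [kappa x = 0]. *)
exists (4 * b x).
  by rewrite mulf_neq0 ?pnatr_eq0 // -sqrf_eq0 b2 // kx expr0n subr0 oner_eq0.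
have near_b : \forall y \near within S2 (nbhs x), 0 < b y * b x.
  have /subspace_continuousP/(_ x Sx) bx := withinM bc (within_cst S2 (b x)).
  apply: (bx [set r | 0 < r]); apply: open_nbhs_nbhs; split; first exact: open_gt.
  have : b x * b x = 1 by rewrite -expr2 b2 // kx expr0n subr0.
  by rewrite /from_subspace /= => ->.
have near_h : \forall y \near within S2 (nbhs x), -1 < core (h y) < 1.
  apply: (cvg_comp _ _ (h_cvg_S2 Wx) (@core_continuous (h x)) [set r | -1 < r < 1]).
  have -> : [set r : R | -1 < r < 1] = `]-1, 1[%classic.
    by apply/seteqP; split => r; rewrite /= in_itv.
  apply: open_nbhs_nbhs; split; first exact: interval_open.
  by rewrite /= in_itv /= /core hx; apply/andP; split; lra.
near=> y.
have Sy : S2 y by near: y; exact: withinT.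
have Wy : W y by near: y; exact: W_open.
have by0 : 0 < b y * b x by near: y.
have hy : -1 < core (h y) < 1 by near: y.
have {hy} ky : kappa y = core (h y).
  by rewrite /kappa asboolT // clamp_id // !ltW //; case/andP: hy.
have [_] := ab y Sy; rewrite /s => aby.
have sE : Num.sqrt (1 - kappa y ^+ 2) = b y * b x.
  rewrite -b2 // sqrtr_sqr -(gtr0_norm by0) normrM.
  have -> : `|b x| = 1 by rewrite -sqrtr_sqr b2 // kx expr0n subr0 sqrtr1.
  by rewrite mulr1.
have b0 : b y != 0 by apply: contraTneq by0 => ->; rewrite mul0r ltxx.
have aE : a y = kappa y * b x by apply: (mulIf b0); move: aby; rewrite sE; lra.
by rewrite aE ky /core; field.
Unshelve. all: end_near. Qed.

(** While the path stays in [W], its projection to [C] lies in the finite set [D], so it is constant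
    near [u0]. The height in the cylinder is then continuous and injective, hence strictly monotone
    through [1/2]. No derivative of the path is involved. *)
Lemma path_sign_change (a : 'rV[R]_3 -> R) (D : set 'rV[R]_3)
    (gam : R -> 'rV[R]_3) (u0 r e : R) :
  finite_set D -> 0 < r ->
  {in `]u0 - r, u0 + r[, continuous gam} ->
  {in `]u0 - r, u0 + r[ &, injective gam} ->
  {in `]u0 - r, u0 + r[, forall u, S2 (gam u)} ->
  {in `]u0 - r, u0 + r[, forall u, W (gam u) -> D (h (gam u)).1} ->
  W (gam u0) -> (h (gam u0)).2 = 1 / 2 -> e != 0 ->
  (\forall y \near within S2 (nbhs (gam u0)), a y = e * ((h y).2 - 1 / 2)) ->
  exists2 d, 0 < d & forall u v, u0 - d < u < u0 -> u0 < v < u0 + d ->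
    a (gam u) * a (gam v) < 0.
Proof.
move=> finD r0 gc gi gS gD Wu0 hu0 e0 ae.
have itv_nbhs u : u \in `]u0 - r, u0 + r[ -> \forall v \near u, v \in `]u0 - r, u0 + r[.
  by move=> ?; apply: near_in_itvoo.
have gS2 u : u \in `]u0 - r, u0 + r[ -> gam @ u --> within S2 (nbhs (gam u)).
  move=> ur P Pu; have {}Pu : \forall y \near gam u, S2 y -> P y := Pu.
  have {}Pu : \forall v \near u, S2 (gam v) -> P (gam v) := gc u ur _ Pu.
  suff : \forall v \near u, P (gam v) by [].
  by apply: filterS2 (itv_nbhs u ur) Pu => v /gS Sv; apply.
have ur0 : u0 \in `]u0 - r, u0 + r[ by rewrite in_itv /= ltrBlDr ltrDl r0.
pose y0 := (h (gam u0)).1.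
(* A finite set is discrete: [D] without [y0] is compact, hence closed. *)
have near_y0 : \forall y \near y0, D y -> y = y0.
  have : closed (D `\ y0).
    apply: compact_closed (@norm_hausdorff _ _) _.
    exact: finite_compact (finite_setD _ finD).
  rewrite -openC => oD; have := open_nbhs_nbhs (conj oD _) => /(_ y0).
  have nD : (~` (D `\ y0)) y0 by move=> [_]; apply.
  move=> /(_ nD); apply: filterS => y nDy Dy; apply: contrapT => yy0; apply: nDy.
  by split.
have [d d0 nd] : exists2 d, 0 < d & forall u, u \in `]u0 - d, u0 + d[ ->
    [/\ u \in `]u0 - r, u0 + r[, W (gam u), (h (gam u)).1 = y0 &
     a (gam u) = e * ((h (gam u)).2 - 1 / 2)].
  have near_ae : \forall u \near u0, a (gam u) = e * ((h (gam u)).2 - 1 / 2) := gS2 u0 ur0 _ ae.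
  have near_W : \forall u \near u0, W (gam u) := gS2 u0 ur0 _ (W_open Wu0).
  have hc := cvg_comp _ _ (gS2 u0 ur0) (h_cvg_S2 Wu0).
  have near_D : \forall u \near u0, D (h (gam u)).1 -> (h (gam u)).1 = y0 :=
    cvg_comp _ _ hc cvg_fst _ near_y0.
  have /nbhs_ballP[d /= d0 nd] : \forall u \near u0, [/\ u \in `]u0 - r, u0 + r[,
      W (gam u), (h (gam u)).1 = y0 & a (gam u) = e * ((h (gam u)).2 - 1 / 2)].
    near=> u; have ur : u \in `]u0 - r, u0 + r[ by near: u; exact: itv_nbhs.
    have Wu : W (gam u) by near: u; exact: near_W.
    split => //; last by near: u; exact: near_ae.
    have : D (h (gam u)).1 -> (h (gam u)).1 = y0 by near: u; exact: near_D.
    by apply; exact: gD.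
  exists d => // u; rewrite in_itv /= => /andP[du ud]; apply: nd.
  by rewrite -ball_normE /= ltr_norml; apply/andP; split; lra.
have sub u : u \in `]u0 - d, u0 + d[ -> u \in `]u0 - r, u0 + r[ by case/nd.
pose g u := (h (gam u)).2.
have gcont : {within [set` `]u0 - d, u0 + d[], continuous g}.
  apply: continuous_subspace_itv => u ud; have [ur Wu _ _] := nd u ud.
  have hc := cvg_comp _ _ (gS2 u ur) (h_cvg_S2 Wu).
  exact: (cvg_comp _ _ hc cvg_snd).
(* The projection being constantly [y0], the height determines the point through [psi]. *)
have ginj : {in `]u0 - d, u0 + d[ &, injective g}.
  move=> u v ud vd guv; apply: gi; [exact: sub|exact: sub|].
  have [_ Wu hu _] := nd u ud; have [_ Wv hv _] := nd v vd.
  rewrite -(hK Wu) -(hK Wv) (surjective_pairing (h (gam u))) (surjective_pairing (h (gam v))).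
  by rewrite hu hv -!/(g _) guv.
exists d => // u v /andP[du uu0] /andP[u0v vd].
have ud : u \in `]u0 - d, u0 + d[ by rewrite in_itv /= du (lt_trans uu0) // ltrDl.
have vdd : v \in `]u0 - d, u0 + d[ by rewrite in_itv /= vd (lt_trans _ u0v) // ltrBlDr ltrDl.
have u0d : u0 \in `]u0 - d, u0 + d[ by rewrite in_itv /= ltrBlDr ltrDl d0.
have [_ _ _ ->] := nd u ud; have [_ _ _ ->] := nd v vdd.
have gu0 : g u0 = 1 / 2 by exact: hu0.
rewrite -/(g u) -/(g v) mulrACA -expr2 pmulr_rlt0 ?exprn_even_gt0 //.
have [mg|mg] := itv_continuous_inj_mono gcont ginj.
  have := mg u u0 ud u0d uu0; have := mg u0 v u0d vdd u0v; rewrite gu0 => h1 h2.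
  by rewrite nmulr_rlt0 ?subr_gt0 ?subr_lt0.
have := mg u0 u u0d ud uu0; have := mg v u0 vdd u0d u0v; rewrite gu0 => h1 h2.
by rewrite pmulr_rlt0 ?subr_gt0 ?subr_lt0.
Unshelve. all: end_near. Qed.

End Cylinder.

(** * Labels *)

Lemma addK4xx (x : K4) : x + x = 0.
Proof. by case: x => [[[|[|]] // ?] [[|[|]] // ?]]; apply/eqP. Qed.

Lemma K4_mulrn_odd (x : K4) n : x *+ n = x *+ odd n.
Proof.
rewrite -[in LHS](odd_double_half n) mulrnDr -muln2 mulnC mulrnA mulr2n addK4xx.
by rewrite mul0rn addr0.
Qed.

Lemma K4_mulrn_addb (x : K4) (b1 b2 : bool) : x *+ (b1 (+) b2) = x *+ b1 + x *+ b2.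
Proof. by case: b1; case: b2; rewrite ?addr0 ?add0r //= addK4xx. Qed.

(** The relation [abc = 1], in additive notation. *)
Lemma K4_sum : \sum_(z in [set K4a; K4b; K4c]%SET) z = 0.
Proof.
by rewrite -finset.setUA big_setU1 ?inE // big_setU1 ?inE // big_set1; apply/eqP.
Qed.

(** Three distinct labels in a set of three elements exhaust it. *)
Lemma sum_half_edges (R : realType) (G : sphere_defects R) (v : vertex G) :
  \sum_(d in half_edges (@ends R G) v) label (inl d.1) = 0.
Proof.
pose lab (d : edge G * bool) : K4 := label (inl d.1).
have lab_inj : {in half_edges (@ends R G) v &, injective lab} by exact: label_vert.
rewrite -[RHS]K4_sum -[LHS](big_imset id lab_inj) /=.
suff -> : [set lab x | x in half_edges (@ends R G) v]%SET = [set K4a; K4b; K4c]%SET by [].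
apply/eqP; rewrite eqEcard card_in_imset // trivalent; apply/andP; split.
  by apply/fintype.subsetP => _ /imsetP[d _ ->]; exact: label_gen.
by rewrite -finset.setUA !cardsU1 cards1 !inE.
Qed.

(** Double counting: since [x + x = 0], each edge contributes separately through its two half-edges,
    which are then regrouped by vertex. *)
Lemma sum_edges (R : realType) (G : sphere_defects R) (m : vertex G -> bool) :
  \sum_(e : edge G) label (inl e) *+ (m (ends e false) (+) m (ends e true)) = 0.
Proof.
transitivity (\sum_(d : edge G * bool) label (inl d.1) *+ m (ends d.1 d.2)).
  rewrite -(pair_bigA _ (fun e b => label (inl e) *+ m (ends e b))) /=.
  by apply: eq_bigr => e _; rewrite big_bool K4_mulrn_addb addrC.
rewrite (partition_big (fun d => ends d.1 d.2) xpredT) //=.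
apply: big1 => v _; rewrite (eq_bigr (fun d => label (inl d.1) *+ m v)).
  rewrite sumrMnl (eq_bigl (fun d => d \in half_edges (@ends R G) v)) ?sum_half_edges ?mul0rn //.
  by move=> d; rewrite inE.
by move=> d /eqP ->.
Qed.

(** * Angular parametrization of the unit circle *)

Section Angle.
Variable R : realType.

Lemma angle_continuous : continuous (@angle R).
Proof.
apply: continuous_rV => i.
have -> : (fun t => angle t 0 i) = (fun t : R => if i == 0 then cos t else sin t).
  by apply/funext => t; rewrite mxE.
by case: (i == 0); [exact: continuous_cos|exact: continuous_sin].
Qed.

Lemma S1E (x : 'rV[R]_2) : S1 R x <-> x 0 0 ^+ 2 + x 0 1 ^+ 2 = 1.
Proof.
rewrite /S1 /= !big_ord_recl big_ord0 addr0.
by have -> : lift ord0 ord0 = 1 :> 'I_2 by apply/val_inj.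
Qed.

Lemma angle_S1 (t : R) : S1 R (angle t).
Proof. by apply/S1E; rewrite !mxE /= cos2Dsin2. Qed.

Lemma angle_period (t : R) : angle (t + 2 * pi) = angle t.
Proof. by apply/rowP => i; rewrite !mxE mulr_natl cosD2pi sinD2pi. Qed.

(** Equal angles give [cos (t - u) = 1], so the sine of half of [|t - u|] vanishes; it would be
    positive if that half were strictly between 0 and [pi]. *)
Lemma angle_inj (t u : R) : `|t - u| < 2 * pi -> angle t = angle u -> t = u.
Proof.
move=> tu /rowP e.
have := e 0; have := e 1; rewrite !mxE /= => es ec.
have c1 : cos (t - u) = 1 by rewrite cosB ec es -!expr2 cos2Dsin2.
have s0 : sin (`|t - u| / 2) = 0.
  have : cos (`|t - u| / 2 + `|t - u| / 2) = 1 by rewrite -splitr cos_norm.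
  rewrite cosD -!expr2 => h; apply/eqP; rewrite -sqrf_eq0; apply/eqP.
  by have := cos2Dsin2 (`|t - u| / 2); lra.
apply/eqP; rewrite -subr_eq0 -normr_eq0; apply/eqP.
have := normr_ge0 (t - u); rewrite le_eqVlt => /predU1P[<- //|tu0].
have : 0 < sin (`|t - u| / 2).
  by apply: sin_gt0_pi; apply/andP; split; lra.
by rewrite s0 ltxx.
Qed.

Lemma angle_surj (t0 : R) (x : 'rV[R]_2) : S1 R x ->
  exists2 t, t0 <= t <= t0 + 2 * pi & angle t = x.
Proof.
move=> /S1E Sx; pose f := t0 + pi.
have cs := cos2Dsin2 f.
(* [x] is rotated by [- f], where [f] is the middle of the wanted interval, so that an angle between
   [- pi] and [pi] can be used. *)
have [|t [/andP[t1 t2] ct st]] := @cos_sin_surj _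
    (x 0 0 * cos f + x 0 1 * sin f) (x 0 1 * cos f - x 0 0 * sin f).
  transitivity ((x 0 0 ^+ 2 + x 0 1 ^+ 2) * (cos f ^+ 2 + sin f ^+ 2)); first by ring.
  by rewrite Sx cs mulr1.
exists (t + f); first by rewrite /f; apply/andP; split; lra.
apply/rowP => -[[|[|//]]] i; rewrite mxE /= ?(cosD t) ?(sinD t) ct st.
  transitivity (x 0 0 * (cos f ^+ 2 + sin f ^+ 2)); first by ring.
  by rewrite cs mulr1; congr (x _ _); apply/val_inj.
transitivity (x 0 1 * (cos f ^+ 2 + sin f ^+ 2)); first by ring.
by rewrite cs mulr1; congr (x _ _); apply/val_inj.
Qed.

End Angle.

(** * Lines crossing the core circle *)

Section Crossings.
Variables (R : realType) (G : sphere_defects R) (f : 'rV[R]_3 -> R^o) (t : R).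
Variables (W : set 'rV[R]_3) (I : set R^o).
Variables (psi : 'rV[R]_3 * R^o -> 'rV[R]_3) (h : 'rV[R]_3 -> 'rV[R]_3 * R^o).
Notation S2 := (S2 R).
Notation C := (level f t).
Hypothesis defects_fin : finite_set (defects G f t).
Hypothesis I_half : I (1 / 2).
Hypothesis h_cont : {within W, continuous h}.
Hypothesis psi_W : forall y, (C `*` I) y -> W (psi y).
Hypothesis h_CI : forall x, W x -> (C `*` I) (h x).
Hypothesis psiK : forall y, (C `*` I) y -> h (psi y) = y.
Hypothesis hK : forall x, W x -> psi (h x) = x.
Hypothesis W_open : forall x, W x -> \forall y \near within S2 (nbhs x), W y.
Hypothesis strata : preserves_strata G C I psi.
Variable a : 'rV[R]_3 -> R.
Hypothesis a_cont : {within S2, continuous a}.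
Hypothesis a_zero : forall x, S2 x -> a x = 0 -> W x /\ (h x).2 = 1 / 2.
Hypothesis a_near : forall x, S2 x -> W x -> (h x).2 = 1 / 2 ->
  exists2 e, e != 0 &
    \forall y \near within S2 (nbhs x), a y = e * ((h y).2 - 1 / 2).
Variable line_at : (edge G + circle G) * 'rV[R]_3 -> edge G + circle G.
Hypothesis line_atP : forall kx, defects G f t kx ->
  line (line_at kx) (psi (kx.2, 1 / 2)) /\ label (line_at kx) = label kx.1.

(** Defects are sorted by the line through the matching point of the core. That line may differ from
    [kx.1], as [psi] is only known to preserve labels. *)
Definition crossings k :=
  [seq kx <- finmap.enum_fset (fset_set (defects G f t)) | line_at kx == k].

Lemma line_inj k k' x : line (G := G) k x -> line k' x -> k = k'.
Proof.
move=> kx k'x; apply: contrapT => kk'.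
have : (line k `&` line k') x by split.
by rewrite /line strata_disjoint.
Qed.

(** Preservation of strata read backwards: inside the cylinder, lines lie over the finitely many
    defects of the level set. *)
Lemma line_W k x : line (G := G) k x -> W x ->
  exists2 k', defects G f t (k', (h x).1) & label k' = label k.
Proof.
move=> kx Wx; have [Cx Ix] := h_CI Wx.
have [_ /(_ (label k))[+ _]] := strata Cx Ix.
rewrite -surjective_pairing hK // => H; have [|k' lk k'x] := H; first by exists k.
by exists k'.
Qed.

Lemma crossings_zero k x : line k x -> a x = 0 ->
  exists2 kx, kx \in crossings k & x = psi (kx.2, 1 / 2).
Proof.
move=> kx ax; have Sx : S2 x by apply: strata_S2 kx.
have [Wx hx] := a_zero Sx ax; have [k' dk' lk'] := line_W kx Wx.
have xE : x = psi ((h x).1, 1 / 2) by rewrite -hx -surjective_pairing hK.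
exists (k', (h x).1) => //.
rewrite mem_filter in_fset_set // mem_set // andbT; apply/eqP.
by have [/= + _] := line_atP dk'; rewrite -xE => /line_inj; apply.
Qed.

Lemma crossingsP k kx : kx \in crossings k ->
  [/\ defects G f t kx, line k (psi (kx.2, 1 / 2)) & a (psi (kx.2, 1 / 2)) = 0].
Proof.
rewrite mem_filter in_fset_set // => /andP[/eqP <- /set_mem dkx].
have [lkx _] := line_atP dkx; split => //.
have CI : (C `*` I) (kx.2, 1 / 2) by split => //; case: dkx.
have Sx : S2 (psi (kx.2, 1 / 2)) by apply: strata_S2 lkx.
have hx : (h (psi (kx.2, 1 / 2))).2 = 1 / 2 by rewrite psiK.
have [e _ ne] := a_near Sx (psi_W CI) hx.
have {}ne : \forall y \near psi (kx.2, 1 / 2), S2 y -> a y = e * ((h y).2 - 1 / 2) := ne.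
by rewrite (nbhs_singleton ne) // hx subrr mulr0.
Qed.

Lemma line_sign_change (k : edge G + circle G) (gam : R -> 'rV[R]_3) u0 r :
  0 < r ->
  {in `]u0 - r, u0 + r[, continuous gam} ->
  {in `]u0 - r, u0 + r[ &, injective gam} ->
  {in `]u0 - r, u0 + r[, forall u, line k (gam u)} ->
  a (gam u0) = 0 ->
  exists2 d, 0 < d & forall u v, u0 - d < u < u0 -> u0 < v < u0 + d ->
    a (gam u) * a (gam v) < 0.
Proof.
move=> r0 gc gi gk au0.
have u0r : u0 \in `]u0 - r, u0 + r[ by rewrite in_itv /= ltrBlDr ltrDl r0.
have gS : {in `]u0 - r, u0 + r[, forall u, S2 (gam u)}.
  by move=> u /gk; apply: strata_S2.
have [Wu0 hu0] := a_zero (gS _ u0r) au0.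
have [e e0 ne] := a_near (gS _ u0r) Wu0 hu0.
apply: (path_sign_change h_cont hK W_open (D := snd @` defects G f t)) gc gi gS _ Wu0 hu0 e0 ne => //.
  exact: finite_image.
by move=> u /gk ku Wu; have [k' dk' _] := line_W ku Wu; exists (k', (h (gam u)).1).
Qed.

(** [sign_parity] is applied to [a] along [gam]; the zeros are the parameters of the crossings. *)
Lemma line_parity (k : edge G + circle G) (gam : R -> 'rV[R]_3) (al be : R) : al < be ->
  {within `[al, be], continuous gam} ->
  {in `[al, be], forall u, S2 (gam u)} ->
  {in `]al, be[ &, injective gam} ->
  {in `]al, be[, forall u, line k (gam u)} ->
  (forall x, line k x -> a x = 0 -> exists u, (u \in `]al, be[) /\ gam u = x) ->
  a (gam al) != 0 -> a (gam be) != 0 ->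
  (a (gam al) < 0) (+) (a (gam be) < 0) = odd (size (crossings k)).
Proof.
move=> albe gc gS gi gk gsurj aal abe.
(* The value 0 off [crossings k] is a mere default. *)
have /choice[u_at u_atP] kx : exists u, kx \in crossings k ->
    (u \in `]al, be[) /\ gam u = psi (kx.2, 1 / 2).
  have [/crossingsP[_ lx ax]|_] := boolP (kx \in crossings k); last by exists 0.
  by have [u ?] := gsurj _ lx ax; exists u.
rewrite -(size_map u_at); apply: (@sign_parity _ (a \o gam)) => //.
- exact: (within_continuous_comp_sub gc a_cont).
(* Equal parameters give the same core point, hence, by injectivity of [psi], the same point of the
   level set; disjointness of the lines then identifies the two defects. *)
- rewrite map_inj_in_uniq; first by rewrite filter_uniq ?finmap.fset_uniq.
  move=> kx kx' ck ck' e.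
  have [_ ex] := u_atP _ ck; have [_ ex'] := u_atP _ ck'.
  have [[l1 c1] _ _] := crossingsP ck; have [[l2 c2] _ _] := crossingsP ck'.
  have : h (gam (u_at kx)) = h (gam (u_at kx')) by rewrite e.
  rewrite ex ex' !psiK // => -[e2].
  rewrite (surjective_pairing kx) (surjective_pairing kx') e2.
  by rewrite (line_inj l1 (k' := kx'.1)) // e2.
- by move=> _ /mapP[kx /u_atP[ukx _] ->].
- move=> u uab; apply/eqP/mapP => [au|[kx ck ->]].
    have [kx ck xE] := crossings_zero (gk u uab) au; exists kx => //.
    by have [uu ue] := u_atP _ ck; apply: gi => //; rewrite ue.
  by have [_ ue] := u_atP _ ck; rewrite /= ue; have [] := crossingsP ck.
- move=> _ /mapP[kx ck ->]; have [uab ue] := u_atP _ ck.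
  have [_ _ ax] := crossingsP ck.
  move: (u_at kx) uab ue => u; rewrite in_itv /= => /andP[au ub] ue.
  pose r := Num.min (u - al) (be - u).
  have r0 : 0 < r by rewrite lt_min !subr_gt0 au.
  have rab v : v \in `]u - r, u + r[ -> v \in `]al, be[.
    have := ge_min (u - al) (u - al) (be - u); have := ge_min (be - u) (u - al) (be - u).
    rewrite -/r !lexx orbT /= !in_itv /= => r1 r2 /andP[h1 h2].
    by apply/andP; split; lra.
  apply: (line_sign_change (k := k) r0).
  - move=> v /rab vab.
    move/continuous_within_itvP : gc => [//|gc _ _].
    exact: gc.
  - by move=> v w /rab vab /rab wab; exact: gi.
  - by move=> v /rab; exact: gk.
  - by rewrite ue.
Qed.

(** A zero of [a] lies in the cylinder, which contains no vertex. *)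
Lemma vertex_nonzero (v : vertex G) : a (vpos v) != 0.
Proof.
apply/eqP => av; have [Wv _] := a_zero (vpos_S2 v) av.
have [Cv Iv] := h_CI Wv; have [+ _] := strata Cv Iv.
by rewrite -surjective_pairing hK //; apply; exists v.
Qed.

Lemma edge_parity (e : edge G) :
  (a (vpos (ends e false)) < 0) (+) (a (vpos (ends e true)) < 0) =
  odd (size (crossings (inl e))).
Proof.
have [h' [_ _ _ h'K _]] := edge_map_embedding e.
have S1' : {in `]0, 1[, forall u : R, line (inl e : edge G + circle G) (edge_map e u)}.
  by move=> u u01; exists u.
rewrite -edge_map0 -edge_map1; apply: line_parity => //.
- exact: edge_map_continuous.
- move=> u; rewrite in_itv /= => /andP[].
  rewrite le_eqVlt => /predU1P[<- _|u0]; first by rewrite edge_map0; exact: vpos_S2.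
  rewrite le_eqVlt => /predU1P[->|u1]; first by rewrite edge_map1; exact: vpos_S2.
  by apply: (@strata_S2 _ _ (inl e)); exists u; rewrite //= in_itv /= u0.
- by move=> u v u01 v01 uv; rewrite -(h'K u) // -(h'K v) // uv.
- by move=> x [u u01 <-] _; exists u.
- by rewrite edge_map0 vertex_nonzero.
- by rewrite edge_map1 vertex_nonzero.
Qed.

(** One turn starts and ends at the same point, so the signs at both ends cancel, provided that the
    starting point is off the core. *)
Lemma circle_parity (l : circle G) : odd (size (crossings (inr l))) = false.
Proof.
have [h' [[ls _] _ _ h'K _]] := circle_map_embedding l.
pose gam (u : R) := circle_map l (angle u).
have gk u : line (inr l) (gam u) by exists (angle u) => //; exact: angle_S1.
have gc : continuous gam.
  apply/continuous_subspace_setT.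
  refine (within_continuous_comp_sub (continuous_subspaceT (@angle_continuous R))
    (smooth_on_continuous ls) _) => u _; exact: (@angle_S1 R u).
have gi u v : `|u - v| < 2 * pi -> gam u = gam v -> u = v.
  move=> uv e; apply: angle_inj => //.
  by have := congr1 h' e; rewrite /gam (h'K _ (angle_S1 u)) (h'K _ (angle_S1 v)).
have pi0 := pi_gt0 R.
(* If [a] vanishes at parameter 0, the sign change there provides nonzero values nearby. *)
have [u0 au0] : exists u0, a (gam u0) != 0.
  have [a0|] := eqVneq (a (gam 0)) 0; last by exists 0.
  have [|||d d0 ad] := @line_sign_change (inr l) gam 0 _ pi0 _ _ _ a0.
  - by move=> u _; exact: gc.
  - move=> u v; rewrite !in_itv /= => /andP[u1 u2] /andP[v1 v2]; apply: gi.
    by rewrite ltr_norml; apply/andP; split; lra.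
  - by move=> u _; exact: gk.
  exists (- (d / 2)); have := ad (- (d / 2)) (d / 2).
  move=> H; have {H} : a (gam (- (d / 2))) * a (gam (d / 2)) < 0.
    by apply: H; apply/andP; split; lra.
  by apply: contraTneq => ->; rewrite mul0r ltxx.
have gper : gam (u0 + 2 * pi) = gam u0 by rewrite /gam angle_period.
rewrite -(@line_parity (inr l) gam u0 (u0 + 2 * pi)) ?gper ?addbb //.
- by rewrite ltrDl mulr_gt0.
- exact: continuous_subspaceT.
- by move=> u _; apply: strata_S2 (gk u).
- move=> u v; rewrite !in_itv /= => /andP[u1 u2] /andP[v1 v2]; apply: gi.
  by rewrite ltr_norml; apply/andP; split; lra.
- move=> x [y Sy <-] ax; have [u /andP[u1 u2] uy] := angle_surj u0 Sy.
  exists u; split; last by rewrite /gam uy.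
  rewrite in_itv /= !lt_neqAle u1 u2 !andbT; apply/andP; split.
    by apply: contraNneq au0 => ->; rewrite /gam uy ax.
  by apply: contraNneq au0 => ue; rewrite -gper -ue /gam uy ax.
Qed.

(** Labels are summed line by line: a line contributes its label times the parity of its crossings.
    Closed lines contribute 0, and edges are handled by [sum_edges], with the vertices where [a] is
    negative marked. *)
Lemma sum_defects : \sum_(kx <- finmap.enum_fset (fset_set (defects G f t))) label kx.1 = 0.
Proof.
rewrite big_seq_cond.
rewrite (eq_bigr (fun kx => label (line_at kx))); last first.
  by move=> kx; rewrite andbT in_fset_set // => /set_mem/line_atP[_ ->].
rewrite -big_seq_cond.
rewrite (partition_big line_at xpredT) //=.
have sizeE k : \sum_(kx <- finmap.enum_fset (fset_set (defects G f t)) | line_at kx == k)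
    label (line_at kx) = label k *+ odd (size (crossings k)).
  rewrite (eq_bigr (fun=> label k)); last by move=> kx /eqP ->.
  by rewrite big_const_seq iter_addr_0 -K4_mulrn_odd size_filter.
rewrite (eq_bigr _ (fun k _ => sizeE k)) big_sumType /=.
rewrite [X in _ + X]big1 ?addr0; last by move=> l _; rewrite circle_parity.
under eq_bigr do rewrite -edge_parity.
exact: (sum_edges (fun v => a (vpos v) < 0)).
Qed.

End Crossings.

(** * The product of the defects on a generic cross-section *)

Lemma slab_open (R : realType) (f : 'rV[R]_3 -> R^o) (t eps : R) :
  {within S2 R, continuous f} -> forall x, slab f t eps x ->
  \forall y \near within (S2 R) (nbhs x), slab f t eps y.
Proof.
move=> /subspace_continuousP fc x [Sx /= fx].
have {}fx : f x \in `](t - eps), (t + eps)[ by rewrite in_itv.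
have near_f : \forall y \near x, S2 R y -> f y \in `](t - eps), (t + eps)[.
  exact: (fc x Sx _ (near_in_itvoo fx)).
suff : \forall y \near x, S2 R y -> slab f t eps y by [].
apply: filterS near_f => y h Sy; split => //=.
by have := h Sy; rewrite in_itv.
Qed.

Theorem theorem5p13 (R : realType) (G : sphere_defects R)
    (f : 'rV[R]_3 -> R^o) (f_morse : morse_function f)
    (f_01 : forall x, S2 R x -> 0 <= f x <= 1)
    (t : R) (t_generic : generic_cross_section G f t) :
  \big[*%g/1%g]_(kx \in defects G f t) label kx.1 = 1%g.
Proof.
have [c [[[c' [[cs _] c1 c'1 _ c'K]] fin]]] := t_generic.
move=> [eps [eps0 [I [psi [I01 [h [[psis hs] psi_W h_CI psiK hK]] _ strata]]]]].
have f_cont := smooth_on_continuous f_morse.1.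
have C_compact : compact (level f t).
  have -> : level f t = c @` S1 R.
    apply/seteqP; split => [y Cy|_ [x Sx <-]]; last exact: c1.
    by exists (c' y); [exact: c'1|exact: c'K].
  exact: continuous_compact (smooth_on_continuous cs) (@compact_sphere R 2).
(* Both forms allowed for [I], open cylinder or collar, contain this band around [1/2]. *)
have I_core (s : R) : 1 / 4 <= s <= 3 / 4 -> I s.
  move=> /andP[s1 s2].
  by case: I01 => ->; rewrite /= in_itv /=; apply/andP; split; lra.
have I_half : I (1 / 2) by apply: I_core; apply/andP; split; lra.
have h_cont := smooth_on_continuous hs.
have W_open := slab_open f_cont (t := t) (eps := eps).
have [a [a_cont a_zero a_near]] :=
  cylinder_separation C_compact I_core (smooth_on_continuous psis) h_cont psi_W h_CI hK W_open.
have /choice[line_at line_atP] (kx : (edge G + circle G) * 'rV[R]_3) :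
    exists k : edge G + circle G, defects G f t kx ->
    line k (psi (kx.2, 1 / 2)) /\ label k = label kx.1.
  have [[lkx Ckx]|ndkx] := pselect (defects G f t kx); last by exists kx.1.
  have [_ /(_ (label kx.1))[_ H]] := strata _ _ Ckx I_half.
  by have [|k lk kpsi] := H; [exists kx.1|exists k].
have sum0 := sum_defects fin I_half h_cont psi_W h_CI psiK hK W_open strata
  a_cont a_zero a_near line_atP.
(* The group law of [K4] is by definition its componentwise addition. *)
transitivity (\big[+%R/0]_(kx \in defects G f t) label kx.1); first by [].
by rewrite fsbig_finite.
Qed.
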